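(* An involutory quandle $Q$ is locally reductive if and only if there exists $n\in\mathbb N$ such that $(L_aL_b)^{2^n}=1$ for every $a,b\in Q$.
   Context: A quandle is an algebra $(Q,*,\backslash)$ satisfying $x\backslash(x*y)=y=x*(x\backslash y)$ (so every left multiplication $L_a:b\mapsto a*b$ is a bijection), $x*(y*z)=(x*y)*(x*z)$ and $x*x=x$. It is involutory if $x*(x*y)=y$. Define $u_0(a,b)=a$ and $u_{n+1}(a,b)=u_n(a,b)*b$. A quandle is $n$-locally reductive if $u_n(a,b)=b$ for all $a,b\in Q$, and locally reductive if it is $n$-locally reductive for some $n\in\mathbb N$. Here $\mathbb N$ includes $0$. *)

(* Defs.v *)
From HB Require Import structures.
From mathcomp Require Import all_boot.

Set Implicit Arguments.
Unset Strict Implicit.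
Unset Printing Implicit Defensive.

Declare Scope quandle_scope.
Delimit Scope quandle_scope with quandle.
Local Open Scope quandle_scope.

(* No eqType, choiceType or finiteness is assumed on the carrier. *)
HB.mixin Record isQuandle Q := {
  qmul : Q -> Q -> Q;
  qldiv : Q -> Q -> Q;
  qmulK : forall x y, qldiv x (qmul x y) = y;
  qldivK : forall x y, qmul x (qldiv x y) = y;
  qmulDr : forall x y z, qmul x (qmul y z) = qmul (qmul x y) (qmul x z);
  qmulxx : forall x, qmul x x = x
}.

#[short(type="quandleType")]
HB.structure Definition Quandle := { Q of isQuandle Q }.

Notation "x * y" := (qmul x y) : quandle_scope.

Definition involutory (Q : quandleType) : Prop :=
  forall x y : Q, x * (x * y) = y.

Definition left_mult (Q : quandleType) (a : Q) : Q -> Q := fun b => a * b.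

Fixpoint u (Q : quandleType) (n : nat) (a b : Q) : Q :=
  if n is m.+1 then u m a b * b else a.

Definition n_locally_reductive (n : nat) (Q : quandleType) : Prop :=
  forall a b : Q, u n a b = b.

Definition locally_reductive (Q : quandleType) : Prop :=
  exists n : nat, n_locally_reductive n Q.

(* Main.v *)
Require Import Defs.
From mathcomp Require Import all_boot.

(** In an involutory quandle the left multiplication by [x * y] is the
    conjugate [L_x L_y L_x], so composing [L_(u_n(a,b))] with [L_b] squares at
    each step: [L_(u_(n+1)) L_b = L_(u_n) L_b L_(u_n) L_b]. Hence
    [(L_a L_b)^(2^n) = L_(u_n(a,b)) L_b] ([iter_exp2_left_mult]).
    If [u_n(a,b) = b], the right-hand side is [L_b L_b = 1]. Conversely, if
    the left-hand side is [1], evaluating at [b], which [L_b] fixes, gives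
    [u_n(a,b) * b = b], that is [u_(n+1)(a,b) = b]; so the index grows by one
    in this direction. *)

(** Left distributivity makes [L_x] an automorphism, so it carries [L_y] to
    [L_(x * y)] by conjugation; here [L_x] is its own inverse. *)
Lemma involutory_left_mult_conj {Q : quandleType} (hQ : involutory Q)
    (x y z : Q) :
  ((x * y) * z = x * (y * (x * z)))%quandle.
Proof. by rewrite qmulDr hQ. Qed.

Lemma iter_exp2_left_mult {Q : quandleType} (hQ : involutory Q)
    (n : nat) (a b x : Q) :
  iter (2 ^ n) (left_mult a \o left_mult b) x = (u n a b * (b * x))%quandle.
Proof.
elim: n x => [|n IHn] x //.
by rewrite expnS mul2n -addnn iterD !IHn /= involutory_left_mult_conj.
Qed.

Theorem corollary3p14 (Q : quandleType) (hQ : involutory Q) :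
  locally_reductive Q <->
  exists n : nat, forall a b : Q,
    iter (2 ^ n) (left_mult a \o left_mult b) =1 id.
Proof.
split=> [[n redQ]|[n expQ]].
  by exists n => a b x; rewrite iter_exp2_left_mult // redQ hQ.
exists n.+1 => a b /=.
by have := expQ a b b; rewrite iter_exp2_left_mult // qmulxx.
Qed.
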